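(* Let $l$ be a positive integer and let $G$ be a left-compressed 3-graph on the vertex set $[l]$ with exactly $m=\binom{l-1}{3}+\binom{l-2}{2}$ edges. Suppose that there are integers $i\ge j\ge 1$ such that the first $j+1$ triples, in the colex ordering, of the complement $G^c=[l]^{(3)}\setminus E(G)$ are, in order, $\{l-2-j,\,l-2,\,l-1\},\ \{l-2-j+1,\,l-2,\,l-1\},\ \dots,\ \{l-3,\,l-2,\,l-1\},\ \{l-2-i,\,l-2,\,l\}$. Then $\lambda(G)<\lambda([l-1]^{(3)})$.
   Context: A 3-graph on $[l]=\{1,\dots,l\}$ is a set $E(G)$ of 3-element subsets of $[l]$; $[t]^{(3)}$ denotes the set of all 3-subsets of $[t]$ (the complete 3-graph on $[t]$). The Lagrangian is $\lambda(G)=\max\{\sum_{abc\in E(G)}x_ax_bx_c : x\in\mathbb{R}^l,\ x_a\ge 0,\ \sum_a x_a=1\}$. $G$ is left-compressed if whenever $j_1j_2j_3\in E(G)$ (with $j_1<j_2<j_3$) and $i_1<i_2<i_3$ satisfy $i_p\le j_p$ for $p=1,2,3$, then $i_1i_2i_3\in E(G)$. The colex ordering on 3-subsets of $\mathbb{N}$: for distinct $A,B$, $A$ precedes $B$ if $\max(A\,\triangle\, B)\in B$, where $\triangle$ is symmetric difference; ''the first $k$ triples'' of a family means its $k$ smallest members in this order. *)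

(* Defs.v *)
From HB Require Import structures.
From mathcomp Require Import all_boot all_order all_algebra.
From mathcomp Require Import all_classical all_reals.
From mathcomp Require Import topology normedtype derive.

Set Implicit Arguments.
Unset Strict Implicit.
Unset Printing Implicit Defensive.

Import Order.TTheory GRing.Theory Num.Theory.
Import numFieldNormedType.Exports.

(* The vertex set [n] = {1, ..., n} is represented by 'I_n, the ordinal v     *)
(* standing for the vertex labelled v.+1; this shift preserves the order.     *)

Definition complete3 (n : nat) : {set {set 'I_n}} := [set e : {set 'I_n} | #|e| == 3].

Definition is_3graph (n : nat) (G : {set {set 'I_n}}) : bool :=
  G \subset complete3 n.

(* The set of vertices with labels a, b, c. It is a 3-set only if these are   *)
(* distinct and lie in {1, ..., n}; a label outside that range is dropped.    *)
Definition triple (n a b c : nat) : {set 'I_n} :=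
  [set v : 'I_n | v.+1 \in [:: a; b; c]].

Definition left_compressed (n : nat) (G : {set {set 'I_n}}) : Prop :=
  forall i1 i2 i3 j1 j2 j3 : 'I_n,
    i1 < i2 < i3 -> j1 < j2 < j3 ->
    i1 <= j1 -> i2 <= j2 -> i3 <= j3 ->
    [set j1; j2; j3] \in G -> [set i1; i2; i3] \in G.

Definition symdiff (T : finType) (A B : {set T}) : {set T} :=
  (A :\: B) :|: (B :\: A).

(* The witness x is max (symdiff A B).                                        *)
Definition colex_lt (n : nat) (A B : {set 'I_n}) : bool :=
  [exists x in symdiff A B,
     [forall y in symdiff A B, y <= x] && (x \in B)].

Definition colex_le (n : nat) (A B : {set 'I_n}) : bool :=
  (A == B) || colex_lt A B.

(* The k smallest members of F, in increasing order (all of F if #|F| < k).   *)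
Definition first_triples (n : nat) (F : {set {set 'I_n}}) (k : nat) :
    seq {set 'I_n} :=
  take k (sort (@colex_le n) (enum F)).

Local Open Scope ring_scope.

Definition simplex (R : realType) (n : nat) : set 'rV[R]_n :=
  [set x | (forall a, 0 <= x 0 a) /\ \sum_a x 0 a = 1]%classic.
Arguments simplex : clear implicits.

Definition lagrange_poly (R : realType) (n : nat) (G : {set {set 'I_n}})
    (x : 'rV[R]_n) : R :=
  \sum_(e in G) \prod_(a in e) x 0 a.

Definition lagrangian (R : realType) (n : nat) (G : {set {set 'I_n}}) : R :=
  sup [set lagrange_poly G x | x in simplex R n]%classic.

Lemma simplex_compact (R : realType) (n : nat) : compact (simplex R n).
Proof.
have -> : simplex R n =
    ([set x : 'rV[R]_n | forall a, `[0, 1]%classic (x ord0 a)] `&`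
     [set x : 'rV[R]_n | \sum_a x 0 a = 1])%classic.
  apply/seteqP; split=> x /= [x0 x1]; split=> // a; last first.
    by have := x0 a; rewrite /= in_itv /= => /andP[].
  rewrite /= in_itv /= x0 /= -x1 (bigD1 a) //= lerDl.
  by apply: sumr_ge0 => b _; exact: x0.
apply: compact_closedI.
  by apply: (@rV_compact R n (fun=> `[0, 1]%classic)) => _;
    exact: segment_compact.
apply: (@closed_comp _ _ (fun x : 'rV[R]_n => \sum_a x 0 a) [set 1%R]%classic).
  move=> x _; apply: continuous_big; first exact: add_continuous.
  by move=> a _; exact: coord_continuous.
exact: closed_eq.
Qed.

(* The supremum is attained: it is the maximum over the simplex.              *)
Lemma lagrangian_max (R : realType) (n : nat) (G : {set {set 'I_n}}) :
  (0 < n)%N ->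
  exists2 x : 'rV[R]_n, simplex R n x &
    lagrangian R G = lagrange_poly G x /\
    forall y, simplex R n y -> lagrange_poly G y <= lagrange_poly G x.
Proof.
case: n G => // n G _.
have cf : continuous (lagrange_poly G : 'rV[R]_n.+1 -> R).
  apply: continuous_big; first exact: add_continuous.
  move=> e _; apply: continuous_big; first exact: mul_continuous.
  by move=> a _; exact: coord_continuous.
have ne : (simplex R n.+1 !=set0)%classic.
  exists (delta_mx 0 0); split=> [a|]; first by rewrite mxE ler0n.
  rewrite (bigD1 ord0) //= mxE !eqxx big1 ?addr0 // => a /negbTE a0.
  by rewrite mxE a0 andbF.
have [x /set_mem Sx xmax] := EVT_max_rV ne (@simplex_compact R n.+1)
  (continuous_subspaceT cf).
have ub y : simplex R n.+1 y -> lagrange_poly G y <= lagrange_poly G x.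
  by move=> /mem_set; exact: xmax.
exists x => //; split=> //; apply/eqP; rewrite eq_le; apply/andP; split.
  by apply: ge_sup => [|_ [y Sy <-]]; [exists (lagrange_poly G x), x | exact: ub].
apply: ub_le_sup; last by exists x.
by exists (lagrange_poly G x) => _ [y Sy <-]; exact: ub.
Qed.

(* Main.v *)
Require Import Defs.
From mathcomp Require Import all_boot all_order all_fingroup all_algebra.
From mathcomp Require Import all_classical all_reals.
From mathcomp Require Import fintype finset ring lra zify.

(* Write l = n + 3, let P < Q < R be the last three vertices and [n] the      *)
(* others. The hypotheses force the complement of G to consist of PQR and of  *)
(* the triples tPQ (t in J), tPR (t in I), tQR (t in U) for sets              *)
(* J <= I <= U of vertices of [n] with |J| + |I| + |U| = n. Take a weighting  *)
(* of G, y on [n] and p, q, r on P, Q, R; swapping weights, we may assume     *)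
(* y >= p >= q >= r. Put s = p + q + r. Compare it with the weighting of the  *)
(* complete 3-graph on n + 2 vertices that replaces y by its mean m and       *)
(* p, q, r by s/2, s/2.                                                       *)
(* If y is constant, the gain is                                              *)
(*   m/4 * (|U| (q+r-p)^2 + |I| (p+r-q)^2 + |J| (p+q-r)^2).                   *)
(* In general, for d = y - m, flattening y gains at least                     *)
(* ((n-1)p + q + r)/2 * sum d^2, and moving the missing weight costs          *)
(* sum (g d) with g constant on J, I \ J, U \ I, [n] \ U. By AM-GM this cost  *)
(* is absorbed by the two gains.                                              *)

Set Implicit Arguments.
Unset Strict Implicit.
Unset Printing Implicit Defensive.

Import Order.TTheory GRing.Theory Num.Theory.

Local Open Scope ring_scope.

(** On the simplex, six times the Lagrange polynomial of a complete 3-graph is [1 - 3 * P2 + 2 * P3]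
    in the power sums ([sum_triples_power_sums]), and the polynomial of [G] is that of the complete
    3-graph minus the weight of the missing triples. Left-compression makes the complement closed
    upwards; with the colex prefix this fixes its shape ([complement_structure]), and the edge count
    leaves [n] missing triples besides [PQR]. Permuting the weights preserves the power sums, so the
    order of the weights is chosen to make the missing weight small ([exists_sorting_perm],
    [missing_weight_swap]).

    What remains is the real inequality [weighted_sum_lt]. There [sum_cube_le] bounds the gain of
    flattening from below, and [variance_le_slack] shows that the squares left over by AM-GM are
    paid for by the gain at constant [y]. That gain is positive when [p > 0], because [J] is
    nonempty; when [p = 0], strictness comes from comparing uniform weightings. *)

(** * The third elementary symmetric polynomial in power sums *)

Section ElementarySymmetric.
Variables (R : fieldType) (T : finType) (x : T -> R).

Let avoiding a k := \sum_(e : {set T} | (#|e| == k) && (a \notin e)) \prod_(b in e) x b.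
Let sigma k := \sum_(e : {set T} | #|e| == k) \prod_(b in e) x b.

Let sigma_containing a k :
  \sum_(e : {set T} | (#|e| == k.+1) && (a \in e)) \prod_(b in e) x b =
  x a * avoiding a k.
Proof.
rewrite big_distrr /=.
rewrite (reindex_onto (fun e => a |: e) (fun e => e :\ a)) /=; last first.
  by move=> e /andP[_ ae]; rewrite setD1K.
apply: eq_big => [e|e /andP[_ /eqP eK]]; last first.
  by rewrite big_setU1 //= -eK !inE eqxx.
have [ae|ae] := boolP (a \in e).
  rewrite [RHS]andbF; apply/negbTE/negP => /andP[_ /eqP eK].
  by move: ae; rewrite -eK !inE eqxx.
by rewrite setU11 setU1K // eqxx cardsU1 ae eqSS !andbT.
Qed.

Let sigmaS a k : sigma k.+1 = x a * avoiding a k + avoiding a k.+1.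
Proof. by rewrite /sigma (bigID (fun e : {set T} => a \in e)) /= sigma_containing. Qed.

(** Double counting: a set of [k.+1] elements arises once from each of its elements. *)
Let sigma_mulr k : k.+1%:R * sigma k.+1 = \sum_a x a * avoiding a k.
Proof.
rewrite /sigma big_distrr /=.
transitivity (\sum_(e : {set T} | #|e| == k.+1) \sum_(a in e) \prod_(b in e) x b).
  by apply: eq_bigr => e /eqP ek; rewrite sumr_const ek mulr_natl.
rewrite (exchange_big_dep predT) //=.
by apply: eq_bigr => a _; rewrite -sigma_containing.
Qed.

Let avoiding0 a : avoiding a 0 = 1.
Proof.
rewrite /avoiding (big_pred1 set0) ?big_set0 // => e /=.
by rewrite cards_eq0; case: eqP => //= ->; rewrite inE.
Qed.

Lemma sum_triples_power_sums :
  6%:R * \sum_(e : {set T} | #|e| == 3%N) \prod_(b in e) x b =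
  (\sum_a x a) ^+ 3 - 3%:R * (\sum_a x a) * (\sum_a x a ^+ 2)
    + 2%:R * \sum_a x a ^+ 3.
Proof.
set S := \sum_a x a; set P2 := \sum_a x a ^+ 2; set P3 := \sum_a x a ^+ 3.
have e1 : sigma 1 = S.
  rewrite -[LHS]mul1r (sigma_mulr 0).
  by apply: eq_bigr => a _; rewrite avoiding0 mulr1.
have av1 a : avoiding a 1 = S - x a.
  by rewrite -e1 (sigmaS a) avoiding0 mulr1 addrC addKr.
have e2 : 2%:R * sigma 2 = S ^+ 2 - P2.
  rewrite (sigma_mulr 1) expr2 {1}/S mulr_suml -sumrB.
  by apply: eq_bigr => a _; rewrite av1; ring.
have av2 a : avoiding a 2 = sigma 2 - x a * (S - x a).
  by rewrite (sigmaS a) av1 addrC addKr.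
have e3 : 3%:R * sigma 3 = S * sigma 2 - P2 * S + P3.
  rewrite (sigma_mulr 2) {1}/S /P2 /P3 !mulr_suml -sumrB -big_split /=.
  by apply: eq_bigr => a _; rewrite av2; ring.
rewrite -/(sigma 3) -[6%N]/(2 * 3)%N natrM -mulrA e3.
have -> : 2%:R * (S * sigma 2 - P2 * S + P3) =
  S * (2%:R * sigma 2) - 2%:R * P2 * S + 2%:R * P3 by ring.
by rewrite e2; ring.
Qed.

End ElementarySymmetric.

(** * The colex order and its initial segments *)

Section Colex.
Variable n : nat.
Implicit Types A B C : {set 'I_n}.

Lemma symdiffE A B x : (x \in symdiff A B) = ((x \in A) != (x \in B)).
Proof. by rewrite !inE; case: (x \in A); case: (x \in B). Qed.

Lemma colex_ltP A B : reflect
  (exists2 x, x \in B :\: A & forall y, (y \in A) != (y \in B) -> (y <= x)%N)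
  (colex_lt A B).
Proof.
apply: (iffP existsP) => [[x /and3P[]]|[x]].
  rewrite symdiffE => xAB /forallP xmax xB; exists x.
    by rewrite inE xB; move: xAB; rewrite xB; case: (x \in A).
  by move=> y yAB; move: (xmax y); rewrite symdiffE yAB.
rewrite inE => /andP[xA xB] xmax; exists x.
rewrite symdiffE xB (negbTE xA) /= andbT; apply/forallP => y.
by rewrite symdiffE; apply/implyP; exact: xmax.
Qed.

Lemma colex_le_total : total (@colex_le n).
Proof.
move=> A B; rewrite /colex_le eq_sym; case: eqP => //= /eqP AB.
have [x xAB] : exists x, (x \in A) != (x \in B).
  apply/existsP; apply: contraNT AB; rewrite negb_exists => /forallP AB.
  by apply/eqP/setP => x; apply/esym/eqP; move: (AB x); rewrite negbK.
pose differ := [pred y : 'I_n | (y \in A) != (y \in B)].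
case: (@arg_maxnP _ x differ (@nat_of_ord n) xAB) => z /= zAB zmax.
apply/orP; have [zB|zB] := boolP (z \in B); [left|right]; apply/colex_ltP; exists z => //.
- by rewrite inE zB; move: zAB; rewrite zB; case: (z \in A).
- by rewrite inE zB; move: zAB; rewrite (negbTE zB); case: (z \in A).
- by move=> y; rewrite eq_sym; apply: zmax.
Qed.

(** The last difference between [A] and [C] is at the larger of the two deciding vertices. *)
Lemma colex_lt_trans : transitive (@colex_lt n).
Proof.
move=> B A C /colex_ltP[x]; rewrite inE => /andP[xA xB] xmax.
move=> /colex_ltP[y]; rewrite inE => /andP[yB yC] ymax.
have bound w : (w \in A) != (w \in C) -> (w <= maxn x y)%N.
  move=> wAC; have [wAB|] := boolP ((w \in A) != (w \in B)).
    by rewrite leq_max xmax.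
  by rewrite negbK => /eqP wAB; rewrite leq_max ymax ?orbT // -wAB.
apply/colex_ltP; have [xy|yx] := leqP x y.
  exists y; last by move=> w /bound; rewrite (maxn_idPr xy).
  rewrite inE yC andbT; apply/negP => yA.
  have := xmax y; rewrite yA (negbTE yB) => /(_ isT) yx.
  have xy' : x = y by apply/val_inj/eqP; rewrite eqn_leq xy.
  by rewrite -xy' xB in yB.
exists x; last by move=> w /bound; rewrite (maxn_idPl (ltnW yx)).
rewrite inE xA /=; apply/negPn/negP => xC.
by have := ymax x; rewrite xB (negbTE xC) leqNgt yx => /(_ isT).
Qed.

Lemma colex_le_trans : transitive (@colex_le n).
Proof.
move=> B A C /orP[/eqP->//|AB] /orP[/eqP<-|BC]; rewrite /colex_le ?AB ?orbT //.
by rewrite (colex_lt_trans AB BC) orbT.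
Qed.

(** These two facts are all that is used later about the sorted list: what lies beyond the prefix
    comes after its last member. *)
Lemma first_triples_rcons (F : {set {set 'I_n}}) k s last :
  first_triples F k = rcons s last ->
  {subset rcons s last <= F} /\
  forall e, e \in F -> e \notin rcons s last -> colex_lt last e.
Proof.
rewrite /first_triples; set w := sort _ _ => wk.
have wF e : (e \in w) = (e \in F) by rewrite mem_sort mem_enum.
split=> [e|e eF eNs]; first by rewrite -wk => /mem_take; rewrite wF.
have : sorted (@colex_le n) w by exact/sort_sorted/colex_le_total.
have := wF e; rewrite -{1 2}(cat_take_drop k w) wk eF mem_cat (negbTE eNs) /=.
move=> ed; rewrite cat_rcons; case/(cat_sorted2) => _.
rewrite /= => /(order_path_min colex_le_trans)/allP/(_ _ ed)/orP[/eqP le|//].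
by move: eNs; rewrite -le mem_rcons inE eqxx.
Qed.
End Colex.

(** * The real inequalities *)

(** Sharp when one entry is [(n - 1) * h] and the others are [- h]. The sum of two entries is
    bounded because the other entries cannot be too negative. *)
Lemma sum_cube_le (R : realFieldType) (n : nat) (d : 'I_n -> R) (h : R) :
  \sum_t d t = 0 -> (forall t, - h <= d t) ->
  \sum_t d t ^+ 3 <= (n%:R - 2) * h * \sum_t d t ^+ 2.
Proof.
move=> d0 dh; set D2 := \sum_t d t ^+ 2; set D3 := \sum_t d t ^+ 3.
case: n d d0 dh @D2 @D3 => [|n] d d0 dh D2 D3.
  by rewrite /D2 /D3 !big_ord0 mulr0.
set N : R := n.+1%:R.
have N0 : 0 < N by rewrite ltr0Sn.
have const_sum (k : R) : \sum_(t < n.+1) k = N * k.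
  by rewrite sumr_const card_ord mulr_natl.
have pair s t : s != t -> d s + d t <= (N - 2) * h.
  move=> st.
  have : 0 <= \sum_(v | (v != s) && (v != t)) (d v + h).
    by apply: sumr_ge0 => v _; have := dh v; lra.
  have : \sum_v (d v + h) = N * h.
    by rewrite big_split /= d0 sumr_const card_ord add0r mulr_natl.
  by rewrite (bigD1 s) //= (bigD1 t) /= 1?eq_sym //; lra.
(* Expanding this sum of nonnegative terms gives the claim. *)
have : 0 <= \sum_s \sum_t (d s - d t) ^+ 2 * ((N - 2) * h - d s - d t).
  apply: sumr_ge0 => s _; apply: sumr_ge0 => t _.
  have [->|st] := eqVneq s t; first by rewrite subrr expr0n mul0r.
  by rewrite mulr_ge0 ?sqr_ge0 //; have := pair s t st; lra.
have inner s : \sum_t (d s - d t) ^+ 2 * ((N - 2) * h - d s - d t) =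
   N * ((N - 2) * h * d s ^+ 2 - d s ^+ 3) + (N - 2) * h * D2 - D3 + d s * D2.
  transitivity (\sum_t (((N - 2) * h * d s ^+ 2 - d s ^+ 3)
     + (d s ^+ 2 - 2 * (N - 2) * h * d s) * d t
     + ((N - 2) * h + d s) * d t ^+ 2 - d t ^+ 3)).
    by apply: eq_bigr => t _; ring.
  rewrite sumrB !big_split /= !const_sum -!mulr_sumr d0 -/D2 -/D3; ring.
rewrite (eq_bigr _ (fun s _ => inner s)) !big_split /= !const_sum -mulr_suml d0.
rewrite -mulr_sumr sumrB -mulr_sumr -/D2 -/D3.
rewrite (_ : _ + _ = (2 * N) * ((N - 2) * h * D2 - D3)); last by ring.
by rewrite pmulr_rge0 ?subr_ge0 // mulr_gt0.
Qed.

(** The left side is twice the sum of [g t ^+ 2] in [weighted_sum_lt], and the last factor on the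
    right is its [slack]. *)
Lemma variance_le_slack (R : realFieldType) (p q r i j u E : R) :
  0 <= r -> r <= q -> q <= p -> 0 <= j -> j <= i -> i <= u ->
  2 * p + q + r <= E ->
  2 * (j * (p ^+ 2 * q ^+ 2 + 2 * p ^+ 2 * q * r) + i * (p ^+ 2 * r ^+ 2)
       + (i + j) * (q ^+ 2 * r ^+ 2)) <=
  p * E * (u * (q + r - p) ^+ 2 + i * (p + r - q) ^+ 2 + j * (p + q - r) ^+ 2).
Proof.
move=> r0 rq qp j0 ji iu hE.
have q0 : 0 <= q by lra.
have p0 : 0 <= p by lra.
set B1 := (q + r - p) ^+ 2 + (p + r - q) ^+ 2 + (p + q - r) ^+ 2.
set B2 := (q + r - p) ^+ 2 + (p + r - q) ^+ 2.
set B3 := (q + r - p) ^+ 2.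
(* [V1] and [V2] are [g ^+ 2] on [J] and on [I :\: J], plus a share of the [i + j] terms
   [q ^+ 2 * r ^+ 2] from outside [U]: two for a vertex of [J], which counts in both [j] and [i],
   and one for a vertex of [I :\: J]. *)
set V1 := r ^+ 2 * p ^+ 2 + 2 * q ^+ 2 * r ^+ 2 + p ^+ 2 * q ^+ 2 + 2 * p ^+ 2 * q * r.
set V2 := r ^+ 2 * (p ^+ 2 + q ^+ 2).
have B10 : 0 <= B1 by rewrite !addr_ge0 ?sqr_ge0.
have B20 : 0 <= B2 by rewrite !addr_ge0 ?sqr_ge0.
have B30 : 0 <= B3 by rewrite sqr_ge0.
have mono B : 0 <= B -> p * (2 * p + q + r) * B <= p * E * B.
  by move=> B0; rewrite ler_wpM2r // ler_wpM2l.
have A1 : 2 * V1 <= p * E * B1.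
  apply: le_trans (mono _ B10); rewrite -subr_ge0.
  (* The difference vanishes at [p = q = r], where [2 * p = s] and [d = 0]; hence a multiple of
     [2 * p - s] plus a multiple of [d ^+ 2]. *)
  set s := q + r; set d := q - r.
  have s0 : 0 <= s by rewrite addr_ge0.
  have sp : s <= 2 * p by rewrite /s; lra.
  have -> : p * (2 * p + q + r) * B1 - 2 * V1 =
     (2 * p - s) * (2 * p ^+ 3 + p * (p - s / 2) * (p + s / 2) + p ^+ 2 * s
                    - p * s ^+ 2 / 4 + s ^+ 3 / 4)
     + (2 * p * (2 * p + s) * d ^+ 2 + (s - d) * (s + d) * d ^+ 2 / 4 + s ^+ 2 * d ^+ 2 / 4).
    by rewrite /B1 /V1 /s /d; field.
  have sd : 0 <= (s - d) * (s + d) by rewrite /s /d mulr_ge0; lra.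
  apply: addr_ge0; last first.
    have h1 : 0 <= p * (2 * p + s) * d ^+ 2 by rewrite mulr_ge0 ?sqr_ge0 ?mulr_ge0 //; lra.
    have h2 : 0 <= (s - d) * (s + d) * d ^+ 2 by rewrite mulr_ge0 ?sqr_ge0.
    have h3 : 0 <= s ^+ 2 * d ^+ 2 by rewrite mulr_ge0 ?sqr_ge0.
    by lra.
  apply: mulr_ge0; first by rewrite subr_ge0.
  have h1 : 0 <= p * (p - s / 2) * (p + s / 2) by rewrite !mulr_ge0 //; lra.
  have h2 : 0 <= p * s * (2 * p - s) by rewrite !mulr_ge0 //; lra.
  have h3 : 0 <= p ^+ 2 * s by rewrite mulr_ge0 ?sqr_ge0.
  have h4 : 0 <= s ^+ 3 by rewrite exprn_ge0.
  have h5 : 0 <= p ^+ 3 by rewrite exprn_ge0.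
  by lra.
have A2 : 2 * V2 <= p * E * B2.
  apply: le_trans (mono _ B20); rewrite -subr_ge0.
  have -> : p * (2 * p + q + r) * B2 - 2 * V2 =
     2 * r ^+ 2 * ((p - q) * (p + q)) + 2 * r ^+ 2 * p * (q + r)
      + 2 * p * (2 * p + q + r) * (p - q) ^+ 2.
    by rewrite /B2 /V2; ring.
  have h1 : 0 <= r ^+ 2 * ((p - q) * (p + q)) by rewrite mulr_ge0 ?sqr_ge0 ?mulr_ge0 //; lra.
  have h2 : 0 <= r ^+ 2 * (p * (q + r)) by rewrite mulr_ge0 ?sqr_ge0 ?mulr_ge0 //; lra.
  have h3 : 0 <= p * (2 * p + q + r) * (p - q) ^+ 2.
    by rewrite mulr_ge0 ?sqr_ge0 ?mulr_ge0 //; lra.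
  by lra.
have E0 : 0 <= E by lra.
have A3 : 0 <= p * E * B3 by rewrite (mulr_ge0 (mulr_ge0 p0 E0)).
(* Both sides are regrouped by the layers of sizes [j], [i - j] and [u - i], to which [A1], [A2] and
   [A3] apply. *)
have -> : 2 * (j * (p ^+ 2 * q ^+ 2 + 2 * p ^+ 2 * q * r) + i * (p ^+ 2 * r ^+ 2)
       + (i + j) * (q ^+ 2 * r ^+ 2)) = j * (2 * V1) + (i - j) * (2 * V2).
  by rewrite /V1 /V2; ring.
have -> : p * E * (u * (q + r - p) ^+ 2 + i * (p + r - q) ^+ 2 + j * (p + q - r) ^+ 2) =
  j * (p * E * B1) + (i - j) * (p * E * B2) + (u - i) * (p * E * B3).
  by rewrite /B1 /B2 /B3; ring.
have h1 : j * (2 * V1) <= j * (p * E * B1) by rewrite ler_wpM2l.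
have h2 : (i - j) * (2 * V2) <= (i - j) * (p * E * B2) by rewrite ler_wpM2l // subr_ge0.
have h3 : 0 <= (u - i) * (p * E * B3) by rewrite mulr_ge0 // subr_ge0.
by lra.
Qed.

(** The left side is six times the weight of [G], and [L] stands for six times the Lagrangian of the
    complete 3-graph, of which only the values at two-valued weightings are needed. *)
Lemma weighted_sum_lt (R : realFieldType) (n : nat) (y : 'I_n -> R) (p q r L : R)
    (J I U : {set 'I_n}) :
  J \subset I -> I \subset U -> (0 < #|J|)%N -> (#|J| + #|I| + #|U|)%N = n ->
  0 <= r -> r <= q -> q <= p -> (forall t, p <= y t) ->
  \sum_t y t + p + q + r = 1 ->
  (forall a b, 0 <= a -> 0 <= b -> n%:R * a + 2 * b = 1 ->
     1 - 3 * (n%:R * a ^+ 2 + 2 * b ^+ 2) + 2 * (n%:R * a ^+ 3 + 2 * b ^+ 3) <= L) ->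
  1 - 3 * (\sum_t y t ^+ 2 + p ^+ 2 + q ^+ 2 + r ^+ 2)
    + 2 * (\sum_t y t ^+ 3 + p ^+ 3 + q ^+ 3 + r ^+ 3)
    - 6 * (p * q * \sum_(t in J) y t + p * r * \sum_(t in I) y t
           + q * r * \sum_(t in U) y t + p * q * r) < L.
Proof.
move=> sJI sIU J0 card r0 rq qp py sum1 hL.
set j : R := #|J|%:R; set i : R := #|I|%:R; set u : R := #|U|%:R; set N : R := n%:R.
have j1 : 1 <= j by rewrite ler1n.
have ji : j <= i by rewrite ler_nat subset_leq_card.
have iu : i <= u by rewrite ler_nat subset_leq_card.
have NE : N = j + i + u by rewrite /N -card !natrD.
have N3 : 3 <= N by lra.
have q0 : 0 <= q by lra.
have p0 : 0 <= p by lra.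
set m := (\sum_t y t) / N.
have NM : N * m = \sum_t y t by rewrite /m mulrC divfK // gt_eqF //; lra.
have const_sum (k : R) : \sum_(t < n) k = N * k by rewrite sumr_const card_ord mulr_natl.
have mp : p <= m.
  rewrite -(ler_pM2l (_ : 0 < N)) ?NM; last lra.
  by rewrite -const_sum; apply: ler_sum => t _.
pose d t := y t - m.
have dE t : y t = m + d t by rewrite /d; ring.
have d0 : \sum_t d t = 0 by rewrite sumrB const_sum NM subrr.
have dh t : - (m - p) <= d t by have := py t; rewrite /d; lra.
have D3le := sum_cube_le d0 dh.
set D2 := \sum_t d t ^+ 2 in D3le; set D3 := \sum_t d t ^+ 3 in D3le.
have Y2 : \sum_t y t ^+ 2 = N * m ^+ 2 + D2.
  transitivity (\sum_t (m ^+ 2 + (2 * m) * d t + d t ^+ 2)).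
    by apply: eq_bigr => t _; rewrite dE; ring.
  by rewrite !big_split /= const_sum -mulr_sumr d0 -/D2; ring.
have Y3 : \sum_t y t ^+ 3 = N * m ^+ 3 + 3 * m * D2 + D3.
  transitivity (\sum_t (m ^+ 3 + (3 * m ^+ 2) * d t + (3 * m) * d t ^+ 2 + d t ^+ 3)).
    by apply: eq_bigr => t _; rewrite dE; ring.
  by rewrite !big_split /= const_sum -!mulr_sumr d0 -/D2 -/D3; ring.
have indic (A : {set 'I_n}) (F : 'I_n -> R) :
    \sum_(t in A) F t = \sum_t (t \in A)%:R * F t.
  rewrite big_mkcond; apply: eq_bigr => t _.
  by case: (t \in A); rewrite ?mul1r ?mul0r.
have indic1 (A : {set 'I_n}) : \sum_t (t \in A)%:R = #|A|%:R :> R.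
  rewrite -sumr_const (indic A (fun=> 1)).
  by apply: eq_bigr => t _; rewrite mulr1.
(* Subtracting q r centres g: it vanishes on U :\: I. *)
pose g t := p * q * (t \in J)%:R + p * r * (t \in I)%:R + q * r * (t \in U)%:R - q * r.
set C := \sum_t g t * d t.
have BE : p * q * \sum_(t in J) y t + p * r * \sum_(t in I) y t
    + q * r * \sum_(t in U) y t = m * (j * (p * q) + i * (p * r) + u * (q * r)) + C.
  have -> : C = \sum_t g t * y t - m * \sum_t g t.
    by rewrite /C mulr_sumr -sumrB; apply: eq_bigr => t _; rewrite /d; ring.
  rewrite /g sumrB !big_split /= const_sum -!mulr_sumr !indic1 -/j -/i -/u !indic.
  transitivity (\sum_t g t * y t + q * r * \sum_t y t).
    rewrite !mulr_sumr -!big_split /=.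
    by apply: eq_bigr => t _; rewrite /g; ring.
  by rewrite -NM NE /g; ring.
(* Outside [U] the value of [g] is [- (q * r)], and [#|J| + #|I| + #|U| = n] makes the number of
   such vertices [i + j]. *)
have VE : \sum_t g t ^+ 2 = j * (p ^+ 2 * q ^+ 2 + 2 * p ^+ 2 * q * r)
    + i * (p ^+ 2 * r ^+ 2) + (i + j) * (q ^+ 2 * r ^+ 2).
  transitivity (\sum_t ((t \in J)%:R * (p ^+ 2 * q ^+ 2 + 2 * p ^+ 2 * q * r)
      + (t \in I)%:R * (p ^+ 2 * r ^+ 2) + (1 - (t \in U)%:R) * (q ^+ 2 * r ^+ 2))).
    apply: eq_bigr => t _; rewrite /g.
    have [tJ|_] := boolP (t \in J).
      by rewrite (subsetP sJI _ tJ) (subsetP sIU _ (subsetP sJI _ tJ)) /=; ring.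
    have [tI|_] := boolP (t \in I); first by rewrite (subsetP sIU _ tI) /=; ring.
    by case: (t \in U) => /=; ring.
  rewrite !big_split /= -!mulr_suml sumrB const_sum !indic1 -/j -/i -/u NE; ring.
set s := p + q + r; set E := (N - 1) * p + q + r.
set slack := u * (q + r - p) ^+ 2 + i * (p + r - q) ^+ 2 + j * (p + q - r) ^+ 2.
have sE : N * m + s = 1 by rewrite NM /s; lra.
have D20 : 0 <= D2 by apply: sumr_ge0 => t _; exact: sqr_ge0.
set K := 1 - 3 * (N * m ^+ 2 + 2 * (s / 2) ^+ 2) + 2 * (N * m ^+ 3 + 2 * (s / 2) ^+ 3).
set F := (X in X < L).
(* The exact gain: the terms in [D2] and [D3] come from flattening [y], [6 * C] from moving the
   missing weight, and the [slack] term is the gain for constant [y]. *)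
have KF : K - F = 3 * (1 - 2 * m) * D2 - 2 * D3 + 6 * C + 3 / 2 * m * slack.
  rewrite /K /F Y2 Y3 BE /slack /s NE.
  have -> : r = 1 - (j + i + u) * m - p - q by move: sE; rewrite NE /s; lra.
  by field.
(* [sum_cube_le] with [h = m - p] costs twice [(N - 2) * (m - p) * D2], while [1 - 2 * m] supplies
   three times that besides [E]. *)
have loss : 3 * E * D2 <= 3 * (1 - 2 * m) * D2 - 2 * D3.
  rewrite -/N in D3le.
  have : 0 <= (N - 2) * (m - p) * D2 by rewrite !mulr_ge0 //; lra.
  have -> : 1 - 2 * m = E + (N - 2) * (m - p) by move: sE; rewrite /E /s; lra.
  by lra.
have KL : K <= L.
  by apply: hL; [lra | rewrite /s; lra | move: sE; rewrite -/N; lra].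
(* If [p = 0], then [slack] and [C] vanish and [m] is [N^-1]; the uniform weighting on [N + 2]
   vertices strictly beats the one on [N]. *)
have [p00|pn0] := eqVneq p 0.
  have qz : q = 0 by lra.
  have rz : r = 0 by lra.
  have FK : F <= K.
    rewrite -subr_ge0 KF; have -> : C = 0.
      by rewrite /C big1 // => t _; rewrite /g p00 qz rz; ring.
    rewrite /slack p00 qz rz.
    move: loss; rewrite /E p00 qz rz; lra.
  apply: le_lt_trans FK _.
  have N2 : N + 2 != 0 by rewrite gt_eqF //; lra.
  have Nn0 : N != 0 by rewrite gt_eqF //; lra.
  have inv0 : 0 <= (N + 2)^-1 by rewrite invr_ge0; lra.
  apply: lt_le_trans (hL (N + 2)^-1 (N + 2)^-1 inv0 inv0 _); last by rewrite -/N; field.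
  have s00 : s = 0 by rewrite /s p00 qz rz; ring.
  have mE : m = N^-1.
    by apply: (mulfI Nn0); rewrite divff //; move: sE; rewrite s00 addr0.
  rewrite -/N /K mE s00 -subr_gt0.
  have -> : 1 - 3 * (N * (N + 2)^-1 ^+ 2 + 2 * (N + 2)^-1 ^+ 2)
     + 2 * (N * (N + 2)^-1 ^+ 3 + 2 * (N + 2)^-1 ^+ 3)
     - (1 - 3 * (N * N^-1 ^+ 2 + 2 * (0 / 2) ^+ 2) + 2 * (N * N^-1 ^+ 3 + 2 * (0 / 2) ^+ 3))
     = (6 * N ^+ 2 + 4 * N - 8) / (N ^+ 2 * (N + 2) ^+ 2).
    by field; rewrite N2 Nn0.
  apply: divr_gt0; last by rewrite mulr_gt0 ?exprn_gt0 //; lra.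
  have : 0 <= N ^+ 2 by exact: sqr_ge0.
  by lra.
have pp : 0 < p by rewrite lt_def pn0.
have slackp : 0 < slack.
  have : 0 < j * (p + q - r) ^+ 2 by apply: mulr_gt0; [lra | rewrite exprn_gt0 //; lra].
  have : 0 <= u * (q + r - p) ^+ 2 by apply: mulr_ge0; [lra | exact: sqr_ge0].
  have : 0 <= i * (p + r - q) ^+ 2 by apply: mulr_ge0; [lra | exact: sqr_ge0].
  by rewrite /slack; lra.
have Ep : 2 * p + q + r <= E.
  have : 0 <= (N - 3) * p by rewrite mulr_ge0 //; lra.
  by rewrite /E; lra.
have E0 : 0 < E by lra.
apply: lt_le_trans KL; rewrite -subr_gt0 -(pmulr_rgt0 _ E0) KF.
(* AM-GM at each vertex. After multiplication by [E], the cost [6 * C] is at most [3 * E ^+ 2 * D2],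
   paid by [lossE], plus three times the sum of [g t ^+ 2], paid by [Vle] out of the share [p] of
   [m * slack]. The surplus is [3 / 2 * (m - p) * E * slack]. *)
have CE : - (E ^+ 2 * D2 + \sum_t g t ^+ 2) <= 2 * E * C.
  rewrite /D2 /C !mulr_sumr -big_split /= -sumrN; apply: ler_sum => t _.
  have : 0 <= (E * d t + g t) ^+ 2 by exact: sqr_ge0.
  by lra.
have := variance_le_slack r0 rq qp (le_trans ler01 j1) ji iu Ep.
rewrite -VE -/slack => Vle.
have lossE : E * (3 * E * D2) <= E * (3 * (1 - 2 * m) * D2 - 2 * D3).
  by rewrite ler_pM2l.
(* The surplus vanishes if [m = p], but then every [y t] equals [p], and the [slack] term alone is
   positive. *)
have [mp'|pm] := eqVneq m p.
  have dz t : d t = 0.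
    have dge t' : 0 <= d t' by have := dh t'; rewrite mp' subrr oppr0.
    move/eqP: d0; rewrite psumr_eq0 => [/allP/(_ t (mem_index_enum _))/eqP //|t' _].
    exact: dge.
  have CZ : C = 0 by rewrite /C big1 // => t _; rewrite dz mulr0.
  have D2Z : D2 = 0 by rewrite /D2 big1 // => t _; rewrite dz expr0n.
  have D3Z : D3 = 0 by rewrite /D3 big1 // => t _; rewrite dz expr0n.
  rewrite CZ D2Z D3Z mp'.
  have : 0 < E * (p * slack) by rewrite !mulr_gt0.
  by lra.
have : 0 < (m - p) * E * slack.
  by rewrite !mulr_gt0 // subr_gt0 lt_def pm.
by lra.
Qed.

(** * The vertex set as [[n]] with three last vertices *)

Section Vertices.
Variable n : nat.

(** With [l = n + 3], the vertices [vP], [vQ], [vR] carry the labels [l - 2], [l - 1], [l]. *)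
Definition emb (t : 'I_n) : 'I_n.+3 :=
  widen_ord (leqnSn _) (widen_ord (leqnSn _) (widen_ord (leqnSn _) t)).
Definition vP : 'I_n.+3 := widen_ord (leqnSn _) (widen_ord (leqnSn _) ord_max).
Definition vQ : 'I_n.+3 := widen_ord (leqnSn _) ord_max.
Definition vR : 'I_n.+3 := ord_max.

Lemma emb_inj : injective emb.
Proof. by move=> s t /(congr1 (@nat_of_ord _)) /= st; apply: val_inj. Qed.

Lemma sum_vertices (V : nmodType) (F : 'I_n.+3 -> V) :
  \sum_v F v = \sum_t F (emb t) + F vP + F vQ + F vR.
Proof. by rewrite !big_ord_recr. Qed.

Variant vertex_spec : 'I_n.+3 -> Type :=
  | VertexEmb t : vertex_spec (emb t)
  | VertexP : vertex_spec vP
  | VertexQ : vertex_spec vQ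
  | VertexR : vertex_spec vR.

Lemma vertexP v : vertex_spec v.
Proof.
have [vn|vn] := ltnP v n.
  rewrite (_ : v = emb (Ordinal vn)); [exact: VertexEmb | exact: val_inj].
have [vn1|vn1] := eqVneq (v : nat) n.
  by rewrite (_ : v = vP); [exact: VertexP | exact: val_inj].
have [vn2|vn2] := eqVneq (v : nat) n.+1.
  by rewrite (_ : v = vQ); [exact: VertexQ | exact: val_inj].
rewrite (_ : v = vR); first exact: VertexR.
by apply: val_inj => /=; have := ltn_ord v; lia.
Qed.

Lemma eq_emb s t : (emb s == emb t) = (s == t).
Proof. exact: (inj_eq emb_inj). Qed.
Lemma emb_neP t : (emb t == vP) = false.
Proof. by rewrite -val_eqE /= ltn_eqF. Qed.
Lemma emb_neQ t : (emb t == vQ) = false.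
Proof. by rewrite -val_eqE /= ltn_eqF // leqW. Qed.
Lemma emb_neR t : (emb t == vR) = false.
Proof. by rewrite -val_eqE /= ltn_eqF // !leqW. Qed.
Lemma vP_neQ : (vP == vQ) = false.
Proof. by rewrite -val_eqE /= ltn_eqF. Qed.
Lemma vP_neR : (vP == vR) = false.
Proof. by rewrite -val_eqE /= ltn_eqF. Qed.
Lemma vQ_neR : (vQ == vR) = false.
Proof. by rewrite -val_eqE /= ltn_eqF. Qed.

Definition vertex_neq := (eq_emb, emb_neP, emb_neQ, emb_neR, vP_neQ, vP_neR, vQ_neR,
  fun t => etrans (eq_sym _ _) (emb_neP t), fun t => etrans (eq_sym _ _) (emb_neQ t),
  fun t => etrans (eq_sym _ _) (emb_neR t), etrans (eq_sym _ _) vP_neQ,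
  etrans (eq_sym _ _) vP_neR, etrans (eq_sym _ _) vQ_neR).

Lemma triple_emb (t : 'I_n) (a b c : nat) (A B : 'I_n.+3) :
  a = t.+1 -> b = A.+1 -> c = B.+1 -> triple n.+3 a b c = [set emb t; A; B].
Proof.
move=> -> -> ->; apply/setP => v; rewrite !inE !eqSS -!val_eqE /=.
by rewrite orbA.
Qed.

Lemma card3_two (e : {set 'I_n.+3}) a b :
  #|e| = 3%N -> a \in e -> b \in e -> a != b ->
  exists2 v, (v != a) && (v != b) & e = [set v; a; b].
Proof.
move=> e3 ae be ab.
have bea : b \in e :\ a by rewrite !inE eq_sym ab.
have /eqP/cards1P[v ev] : #|e :\ a :\ b| = 1%N.
  by move: e3; rewrite (cardsD1 a) ae (cardsD1 b) bea /=; lia.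
exists v; last first.
  by rewrite -(setD1K ae) -(setD1K bea) ev; apply/setP => w; rewrite !inE; lia.
have : v \in e :\ a :\ b by rewrite ev inE.
by rewrite !inE => /and3P[-> -> _].
Qed.

Lemma card3 (T : finType) (a b c : T) :
  a != b -> a != c -> b != c -> #|[set a; b; c]| = 3%N.
Proof.
move=> ab ac bc.
by rewrite -setUA cardsU1 cards2 !inE (negbTE ab) (negbTE ac) bc.
Qed.

Lemma prod_triple (R : comPzRingType) (T : finType) (x : T -> R) a b c :
  a != b -> a != c -> b != c ->
  \prod_(v in [set a; b; c]) x v = x a * x b * x c.
Proof.
move=> ab ac bc; rewrite -setUA big_setU1 /=; last by rewrite !inE negb_or ab.
by rewrite big_setU1 ?big_set1 ?mulrA // inE.
Qed.

Lemma triple_emb_inj a b : (forall t, emb t != a) -> (forall t, emb t != b) ->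
  injective (fun t => [set emb t; a; b]).
Proof.
move=> ha hb s t /setP/(_ (emb s)).
by rewrite !inE eqxx eq_emb (negbTE (ha s)) (negbTE (hb s)) !orbF => /esym/eqP.
Qed.

End Vertices.

(** * The shape of the complement *)

Section Complement.
Variables (n i j : nat) (G : {set {set 'I_n.+3}}).
Hypothesis hlc : left_compressed G.
Hypotheses (hj : (1 <= j)%N) (hij : (j <= i)%N) (hin : (i <= n)%N).
Let C := complete3 n.+3 :\: G.
Let s := [seq triple n.+3 (n.+1 - j + k) n.+1 n.+2 | k <- iota 0 j].
Let last := triple n.+3 (n.+1 - i) n.+1 n.+3.
Hypothesis s_last_C : {subset rcons s last <= C}.
Hypothesis after_last : forall e, e \in C -> e \notin rcons s last -> colex_lt last e.

Let P := vP n.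
Let Q := vQ n.
Let Z := vR n.
Let J := [set t : 'I_n | (n - j <= t)%N].
Let I := [set t : 'I_n | (n - i <= t)%N].
(** The prefix does not determine this set, so it is read off from the complement. *)
Let U := [set t : 'I_n | [set emb t; Q; Z] \in C].

Let inC (e : {set 'I_n.+3}) : (e \in C) = (#|e| == 3%N) && (e \notin G).
Proof. by rewrite !inE andbC. Qed.

(** Contrapositive of left-compression. *)
Let up_closed (a1 a2 a3 b1 b2 b3 : 'I_n.+3) :
  (a1 < a2 < a3)%N -> (b1 < b2 < b3)%N -> (a1 <= b1)%N -> (a2 <= b2)%N -> (a3 <= b3)%N ->
  [set a1; a2; a3] \in C -> [set b1; b2; b3] \in C.
Proof.
move=> ha hb h1 h2 h3; rewrite !inC => /andP[_ aG].
have /andP[b12 b23] := hb.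
have ne (v w : 'I_n.+3) : (v < w)%N -> v != w by move=> vw; rewrite -val_eqE ltn_eqF.
rewrite card3 ?ne // ?(ltn_trans b12) //=.
by apply: contraNN aG => bG; apply: (hlc ha hb h1 h2 h3).
Qed.

Let n_gt0 : (0 < n)%N. Proof. exact: leq_trans hj (leq_trans hij hin). Qed.

Let t0_lt : (n - i < n)%N. Proof. have := n_gt0; lia. Qed.
Let t0 := Ordinal t0_lt.

Let lastE : last = [set emb t0; P; Z].
Proof. by apply: triple_emb => //=; rewrite subSn. Qed.

Let last_C : [set emb t0; P; Z] \in C.
Proof. by rewrite -lastE; apply: s_last_C; rewrite mem_rcons mem_head. Qed.

Let sP e : reflect (exists2 t, t \in J & e = [set emb t; P; Q]) (e \in s).
Proof.
apply: (iffP mapP) => [[k]|[t]].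
  rewrite mem_iota add0n => kj ->.
  have tn : (n - j + k < n)%N by lia.
  exists (Ordinal tn); first by rewrite inE /= leq_addr.
  by apply: triple_emb => //=; lia.
rewrite inE => tJ ->; exists (t - (n - j))%N.
  by rewrite mem_iota; have := ltn_ord t; lia.
by apply/esym/triple_emb => //=; lia.
Qed.

(** Since [last] contains [Z], a triple without [Z] precedes it, so a missing one must be listed in
    [s]. *)
Let PQ_part : [set e in C | Z \notin e] = [set [set emb t; P; Q] | t in J].
Proof.
apply/setP => e; rewrite inE; apply/andP/imsetP => [[eC Ze]|tJ].
  apply/sP; have [|/(after_last eC)/colex_ltP] := boolP (e \in rcons s last).
    rewrite mem_rcons inE => /orP[/eqP el|//].
    by move: Ze; rewrite el lastE !inE eqxx !orbT.
  case=> x; rewrite inE => /andP[xl xe] /(_ Z).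
  rewrite lastE !inE eqxx !orbT (negbTE Ze) => /(_ isT) Zx.
  have : x = Z by apply: val_inj; apply/eqP; rewrite eqn_leq Zx -ltnS ltn_ord.
  by move=> xZ; rewrite xZ (negbTE Ze) in xe.
split.
  apply: s_last_C; rewrite mem_rcons inE; apply/orP; right.
  exact/sP.
by case: tJ => t _ ->; rewrite !inE !vertex_neq.
Qed.

(** Upward closure from [last] gives all [t >= t0]. Conversely, a missing triple of this kind other
    than [last] comes after [last], hence contains [P] and a vertex above [t0]. *)
Let PR_part : [set e in C | (Z \in e) && (Q \notin e)] = [set [set emb t; P; Z] | t in I].
Proof.
apply/setP => e; rewrite inE; apply/andP/imsetP => [[eC /andP[Ze Qe]]|[t tI ->]]; last first.
  split; last by rewrite !inE !vertex_neq !eqxx !orbT.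
  apply: up_closed last_C => //=; last by move: tI; rewrite inE.
    by rewrite t0_lt leqnSn.
  by rewrite ltn_ord leqnSn.
have e3 : #|e| = 3%N by move: eC; rewrite inC => /andP[/eqP].
have mem_last v : v \in last = (v \in [set emb t0; P; Z]) by rewrite lastE.
have [|/(after_last eC)/colex_ltP] := boolP (e \in rcons s last).
  rewrite mem_rcons inE => /orP[/eqP ->|/sP[t _ et]].
    by exists t0; rewrite ?inE ?lastE.
  by move: Ze; rewrite et !inE !vertex_neq.
case=> x; rewrite inE mem_last => /andP[xl xe] xmax.
(* Otherwise the deciding vertex [x] would be at least [P]; but [e] avoids [P] and [Q], and [Z] lies
   in [last]. *)
have Pe : P \in e.
  apply/negPn/negP => Pe; have := xmax P.
  rewrite mem_last !inE eqxx (negbTE Pe) !orbT => /(_ isT).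
  case: (vertexP x) xl xe => [t|||] xl xe.
  - by rewrite /= leqNgt ltn_ord.
  - by rewrite -/P (negbTE Pe) in xe.
  - by rewrite -/Q (negbTE Qe) in xe.
  - by rewrite !inE eqxx orbT in xl.
have PZ : P != Z by rewrite vertex_neq.
have [v /andP[vP vZ] ev] := card3_two e3 Pe Ze PZ.
have vQ : v != Q by apply: contraNneq Qe => <-; rewrite ev !inE eqxx.
move: ev vP vZ vQ; case: (vertexP v) => [t|||] ev; rewrite ?eqxx // => _ _ _.
exists t => //; rewrite inE.
have [->//|tt0] := eqVneq t t0.
have xt : x = emb t.
  by move: xl xe; rewrite ev !inE !negb_or -andbA => /and3P[_ /negbTE-> /negbTE->];
     rewrite !orbF => /eqP.
have := xmax (emb t0).
rewrite mem_last ev !inE !eq_emb eqxx (eq_sym t0) (negbTE tt0) !vertex_neq /= => /(_ isT).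
by rewrite xt.
Qed.

Let PQR_C : [set P; Q; Z] \in C.
Proof.
by apply: up_closed last_C => //=; have := n_gt0; lia.
Qed.

Let QR_part : [set e in C | (Z \in e) && (Q \in e)] =
  [set P; Q; Z] |: [set [set emb t; Q; Z] | t in U].
Proof.
apply/setP => e; rewrite inE in_setU1; apply/andP/idP => [[eC /andP[Ze Qe]]|].
  have e3 : #|e| = 3%N by move: eC; rewrite inC => /andP[/eqP].
  have QZ : Q != Z by rewrite vertex_neq.
  have [v /andP[vQ vZ] ev] := card3_two e3 Qe Ze QZ.
  move: ev vQ vZ; case: (vertexP v) => [t|||] ev; rewrite ?eqxx // => _ _.
    by apply/orP; right; apply/imsetP; exists t => //; rewrite inE -ev.
  by rewrite ev eqxx.
case/orP => [/eqP->|/imsetP[t tU ->]].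
  by rewrite PQR_C !inE !eqxx !orbT.
by move: tU; rewrite inE => ->; rewrite !inE !eqxx !orbT.
Qed.

Let sum_complement (V : nmodType) (F : {set 'I_n.+3} -> V) :
  \sum_(e in C) F e = \sum_(t in J) F [set emb t; P; Q] + \sum_(t in I) F [set emb t; P; Z]
    + \sum_(t in U) F [set emb t; Q; Z] + F [set P; Q; Z].
Proof.
have split_sum (p : pred {set 'I_n.+3}) :
    \sum_(e in C | p e) F e = \sum_(e in [set e in C | p e]) F e.
  by apply: eq_bigl => e; rewrite inE.
rewrite (bigID (fun e : {set _} => Z \in e)) /= addrC split_sum PQ_part -!addrA.
rewrite big_imset /=; last first.
  by move=> t u _ _; apply: triple_emb_inj => v; rewrite vertex_neq.
congr (_ + _); rewrite (bigID (fun e : {set _} => Q \in e)) /= addrC.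
under eq_bigl do rewrite -andbA; rewrite split_sum PR_part.
rewrite big_imset /=; last first.
  by move=> t u _ _; apply: triple_emb_inj => v; rewrite vertex_neq.
congr (_ + _); under eq_bigl do rewrite -andbA; rewrite split_sum QR_part.
rewrite big_setU1 /=; last first.
  apply/imsetP => -[t _ /setP/(_ P)]; by rewrite !inE eqxx !vertex_neq.
rewrite addrC big_imset //= => t u _ _.
by apply: triple_emb_inj => v; rewrite vertex_neq.
Qed.

(** The sum is split in an arbitrary commutative monoid, so that one formula both counts the missing
    triples and gives their weight. *)
Lemma complement_structure : exists J I U : {set 'I_n},
  [/\ J \subset I, I \subset U, #|J| = j,
   (#|J| + #|I| + #|U|).+1 = #|C| &
   forall (V : nmodType) (F : {set 'I_n.+3} -> V), \sum_(e in C) F e =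
    \sum_(t in J) F [set emb t; vP n; vQ n] + \sum_(t in I) F [set emb t; vP n; vR n]
    + \sum_(t in U) F [set emb t; vQ n; vR n] + F [set vP n; vQ n; vR n] ].
Proof.
exists J, I, U; split.
- by apply/subsetP => t; rewrite !inE; apply: leq_trans; rewrite leq_sub2l.
- apply/subsetP => t; rewrite inE => tI; rewrite inE.
  by apply: up_closed last_C => //=; have := ltn_ord t; lia.
- rewrite -[RHS](size_iota (n - j)) cardE.
  rewrite -(size_map (@nat_of_ord n)); apply: perm_size.
  apply: uniq_perm; rewrite ?iota_uniq ?(map_inj_uniq val_inj) ?enum_uniq // => k.
  rewrite mem_iota; apply/mapP/idP => [[t]|kj].
    by rewrite mem_enum inE => ? ->; have := ltn_ord t; lia.
  have kn : (k < n)%N by lia.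
  by exists (Ordinal kn) => //; rewrite mem_enum inE /=; lia.
- have := sum_complement (fun=> 1%N); rewrite !sum1_card /= => ->.
  by rewrite -addn1.
- exact: sum_complement.
Qed.

End Complement.

(** * Sorting the weights *)

(** Bubble sort as an extremal argument: among the permutations with minimal [B], one minimizing
    [Phi] has no inversion along [E], since undoing an inversion would lower [Phi] without raising
    [B]. *)
Lemma exists_sorting_perm (R : realFieldType) (l : nat) (x : 'I_l -> R)
    (B : 'S_l -> R) (E : rel 'I_l) :
  (forall a b, E a b -> (a < b)%N) ->
  (forall (s : 'S_l) a b, E a b -> x (s a) < x (s b) -> B (tperm a b * s)%g <= B s) ->
  exists2 s, B s <= B 1%g & forall a b, E a b -> x (s b) <= x (s a).
Proof.
move=> E_lt B_swap.
case: (@arg_minP _ _ _ (1%g : 'S_l) predT B isT) => s0 _ s0_min.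
pose Phi (s : 'S_l) := \sum_(v < l) (v : nat)%:R * x (s v).
case: (@arg_minP _ _ _ s0 (fun s => B s <= B s0) Phi (lexx _)) => s s_min Phi_min.
exists s => [|a b Eab]; first exact: le_trans s_min (s0_min _ isT).
rewrite leNgt; apply/negP => sab.
have := Phi_min (tperm a b * s)%g (le_trans (B_swap _ _ _ Eab sab) s_min).
have ab := E_lt _ _ Eab.
have ba : b != a by rewrite -val_eqE gtn_eqF.
rewrite /Phi (bigD1 a) //= (bigD1 b) //= [X in _ <= X](bigD1 a) //=.
rewrite [X in _ <= _ + X](bigD1 b) //=.
rewrite !permM tpermL tpermR.
rewrite [X in _ <= _ + (_ + X)](eq_bigr (fun v : 'I_l => (v : nat)%:R * x (s v))); last first.
  by move=> v /andP[va vb]; rewrite permM tpermD // eq_sym.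
have abR : 0 < (b : nat)%:R - (a : nat)%:R :> R by rewrite subr_gt0 ltr_nat.
have : 0 < ((b : nat)%:R - (a : nat)%:R) * (x (s b) - x (s a)).
  by rewrite mulr_gt0 // subr_gt0.
lra.
Qed.

(** * Lagrange polynomials of complete 3-graphs and complements *)

Lemma lagrange_complete3 (R : realType) (n : nat) (x : 'rV[R]_n) :
  6 * lagrange_poly (complete3 n) x =
  (\sum_a x 0 a) ^+ 3 - 3 * (\sum_a x 0 a) * (\sum_a x 0 a ^+ 2) + 2 * \sum_a x 0 a ^+ 3.
Proof.
rewrite -sum_triples_power_sums /lagrange_poly; congr (_ * _).
by apply: eq_bigl => e; rewrite inE.
Qed.

Lemma lagrange_complement (R : realType) (n : nat) (G : {set {set 'I_n}}) (x : 'rV[R]_n) :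
  is_3graph G -> lagrange_poly G x =
  lagrange_poly (complete3 n) x - \sum_(e in complete3 n :\: G) \prod_(a in e) x 0 a.
Proof.
move=> /setIidPr GE; rewrite /lagrange_poly (big_setID G (A := complete3 n)) /= GE.
by rewrite addrK.
Qed.

(** Test weighting: [a] on the first [n] vertices and [b] on the last two. *)
Lemma lagrangian_complete_ge (R : realType) (n : nat) (a b : R) :
  0 <= a -> 0 <= b -> n%:R * a + 2 * b = 1 ->
  1 - 3 * (n%:R * a ^+ 2 + 2 * b ^+ 2) + 2 * (n%:R * a ^+ 3 + 2 * b ^+ 3) <=
  6 * lagrangian R (complete3 n.+2).
Proof.
move=> a0 b0 ab.
pose x : 'rV[R]_n.+2 := \row_v (if (v < n)%N then a else b).
have power_sum k : \sum_v x 0 v ^+ k = n%:R * a ^+ k + 2 * b ^+ k.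
  rewrite !big_ord_recr /= !mxE /= ltnn ltnNge leqnSn /=.
  under eq_bigr do rewrite mxE /= ltn_ord.
  by rewrite sumr_const card_ord -[_ *+ n]mulr_natl; ring.
have sum_x : \sum_v x 0 v = 1.
  by rewrite -ab -[a]expr1 -[b]expr1 -power_sum; apply: eq_bigr => v _; rewrite expr1.
have Sx : simplex R n.+2 x.
  by split=> // v; rewrite mxE; case: ifP.
have [z _ [-> zmax]] := @lagrangian_max R n.+2 (complete3 n.+2) isT.
have : 6 * lagrange_poly (complete3 n.+2) x <= 6 * lagrange_poly (complete3 n.+2) z.
  by rewrite ler_pM2l ?zmax.
apply: le_trans; rewrite lagrange_complete3 sum_x !power_sum.
by rewrite expr1n mulr1.
Qed.

(** * Effect of a swap on the missing weight *)

Section MissingWeight.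
Variables (R : realFieldType) (n : nat) (J I U : {set 'I_n}).
Hypotheses (sJI : J \subset I) (sIU : I \subset U).

Definition missing_weight (x : 'I_n.+3 -> R) : R :=
  x (vP n) * x (vQ n) * \sum_(t in J) x (emb t) +
  x (vP n) * x (vR n) * \sum_(t in I) x (emb t) +
  x (vQ n) * x (vR n) * \sum_(t in U) x (emb t) +
  x (vP n) * x (vQ n) * x (vR n).

(** These pairs generate exactly the order wanted, [y >= p >= q >= r]; nothing is imposed inside
    [[n]]. *)
Definition swap_edge : rel 'I_n.+3 := fun a b =>
  [|| (a < n)%N && (b == vP n), (a == vP n) && (b == vQ n) |
      (a == vQ n) && (b == vR n)].

(** In each case the decrease factors as [x b - x a] times a nonnegative quantity, by [J \subset I]
    and [I \subset U] for the swaps among the last three vertices. *)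
Lemma missing_weight_swap (x : 'I_n.+3 -> R) a b :
  (forall v, 0 <= x v) -> swap_edge a b -> x a < x b ->
  missing_weight (fun v => x (tperm a b v)) <= missing_weight x.
Proof.
move=> x0 Eab xab.
have sub_sum (A A' : {set 'I_n}) : A \subset A' ->
    \sum_(t in A) x (emb t) <= \sum_(t in A') x (emb t).
  move=> sA; rewrite [leRHS](big_setID A) /= (setIidPr sA) lerDl.
  by apply: sumr_ge0 => t _.
have p0 := x0 (vP n); have q0 := x0 (vQ n); have r0 := x0 (vR n).
have fixed c v w : v != c -> w != c -> tperm v w c = c by move=> vc wc; rewrite tpermD.
rewrite -subr_ge0 /missing_weight.
have sum_tperm (A : {set 'I_n}) v w : (forall t, v != emb t) -> (forall t, w != emb t) ->
    \sum_(t in A) x (tperm v w (emb t)) = \sum_(t in A) x (emb t).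
  by move=> hv hw; apply: eq_bigr => t _; rewrite fixed.
case/or3P: Eab xab => /andP[].
- move=> an /eqP-> xab; have aE : a = emb (Ordinal an) by exact: val_inj.
  move: xab; rewrite aE; move: (Ordinal an) => t xab.
  rewrite tpermR !fixed ?vertex_neq //.
  pose rest (A : {set 'I_n}) := \sum_(u in A | u != t) x (emb u).
  have sumE (A : {set 'I_n}) : \sum_(u in A) x (emb u) = rest A + (t \in A)%:R * x (emb t).
    rewrite /rest; have [tA|tA] := boolP (t \in A).
      by rewrite (bigD1 t) //= mul1r addrC.
    rewrite mul0r addr0; apply: eq_bigl => u.
    by have [->|] := eqVneq u t; rewrite ?andbT ?(negbTE tA).
  have sumE' (A : {set 'I_n}) : \sum_(u in A) x (tperm (emb t) (vP n) (emb u)) =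
      rest A + (t \in A)%:R * x (vP n).
    have restE : \sum_(u in A | u != t) x (tperm (emb t) (vP n) (emb u)) = rest A.
      by apply: eq_bigr => u /andP[_ ut]; rewrite tpermD ?vertex_neq // eq_sym.
    rewrite -restE; have [tA|tA] := boolP (t \in A).
      by rewrite (bigD1 t) //= mul1r tpermL addrC.
    rewrite mul0r addr0; apply: eq_bigl => u.
    by have [->|] := eqVneq u t; rewrite ?andbT ?(negbTE tA).
  rewrite !sumE !sumE'.
  have rest0 A : 0 <= rest A by apply: sumr_ge0.
  rewrite (_ : _ - _ = (x (vP n) - x (emb t)) *
    (x (vQ n) * rest J + x (vR n) * rest I + x (vQ n) * x (vR n) * (1 - (t \in U)%:R))).
    rewrite mulr_ge0 ?subr_ge0 ?(ltW xab) // !addr_ge0 ?mulr_ge0 ?rest0 //.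
    by rewrite subr_ge0; case: (t \in U).
  by ring.
- move=> /eqP-> /eqP-> xab.
  rewrite tpermL tpermR fixed ?vertex_neq //.
  rewrite !sum_tperm; do ?by move=> t; rewrite vertex_neq.
  have : 0 <= x (vR n) * (x (vQ n) - x (vP n)) *
      (\sum_(t in U) x (emb t) - \sum_(t in I) x (emb t)).
    by rewrite !mulr_ge0 ?subr_ge0 ?sub_sum // ltW.
  by lra.
move=> /eqP-> /eqP-> xab.
rewrite tpermL tpermR fixed ?vertex_neq //.
rewrite !sum_tperm; do ?by move=> t; rewrite vertex_neq.
have : 0 <= x (vP n) * (x (vR n) - x (vQ n)) *
    (\sum_(t in I) x (emb t) - \sum_(t in J) x (emb t)).
  by rewrite !mulr_ge0 ?subr_ge0 ?sub_sum // ltW.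
by lra.
Qed.

End MissingWeight.

(** * Conclusion *)

Lemma lagrangian_lt (R : realType) (n i j : nat) (G : {set {set 'I_n.+3}}) :
  let C := complete3 n.+3 :\: G in
  let ts := [seq triple n.+3 (n.+1 - j + k) n.+1 n.+2 | k <- iota 0 j] in
  let last := triple n.+3 (n.+1 - i) n.+1 n.+3 in
  is_3graph G -> left_compressed G -> (1 <= j)%N -> (j <= i)%N -> (i <= n)%N ->
  #|C| = n.+1 -> {subset rcons ts last <= C} ->
  (forall e, e \in C -> e \notin rcons ts last -> colex_lt last e) ->
  lagrangian R G < lagrangian R (complete3 n.+2).
Proof.
move=> C ts last hG hlc hj hij hin hC sub_C after_last.
have [J [I [U [sJI sIU cardJ cardC sumC]]]] :=
  complement_structure hlc hj hij hin sub_C after_last.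
have cardJIU : (#|J| + #|I| + #|U| = n)%N by move: cardC; rewrite hC => -[].
have [x [x_ge0 x_sum] [-> _]] := @lagrangian_max R n.+3 G isT.
pose B (s : 'S_n.+3) := missing_weight J I U (fun v => x 0 (s v)).
have [|s a b|s sB s_sorted] := @exists_sorting_perm R n.+3 (x 0) B (@swap_edge n).
- move=> a b /or3P[] /andP[].
  + by move=> an /eqP->.
  + by move=> /eqP-> /eqP->.
  + by move=> /eqP-> /eqP->.
- move=> Eab sab.
  have := missing_weight_swap sJI sIU (fun v => x_ge0 (s v)) Eab sab.
  rewrite /B (_ : (fun v => x 0 ((tperm a b * s)%g v)) = (fun v => x 0 (s (tperm a b v)))) //.
  by apply/funext => v; rewrite permM.
have B1 : \sum_(e in complete3 n.+3 :\: G) \prod_(v in e) x 0 v = B 1%g.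
  rewrite sumC /B /missing_weight !perm1 !mulr_sumr.
  rewrite prod_triple ?vertex_neq //; congr (_ + _ + _ + _); apply: eq_bigr => t _.
  - by rewrite perm1 prod_triple ?vertex_neq //; ring.
  - by rewrite perm1 prod_triple ?vertex_neq //; ring.
  - by rewrite perm1 prod_triple ?vertex_neq //; ring.
pose y v := x 0 (s v).
have power_sum k : \sum_v x 0 v ^+ k = \sum_v y v ^+ k.
  by rewrite (reindex_inj (@perm_inj _ s)).
have y_sum : \sum_v y v = 1.
  by rewrite -x_sum [RHS](reindex_inj (@perm_inj _ s)).
rewrite -(@ltr_pM2l _ 6) // lagrange_complement // B1 mulrBr lagrange_complete3.
rewrite x_sum !power_sum expr1n mulr1.
(* The power sums are already those of the sorted weights [y]; replacing [B 1] by the smaller [B s]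
   can only increase the value. *)
apply: (@le_lt_trans _ _ (1 - 3 * (\sum_v y v ^+ 2) + 2 * (\sum_v y v ^+ 3) - 6 * B s)).
  by rewrite lerD2l lerN2 ler_pM2l.
rewrite !sum_vertices /B /missing_weight.
apply: (weighted_sum_lt sJI sIU) => //.
- by rewrite cardJ.
- exact: x_ge0.
- by apply: s_sorted; rewrite /swap_edge !eqxx !orbT.
- by apply: s_sorted; rewrite /swap_edge !eqxx !orbT.
- by move=> t; apply: s_sorted; rewrite /swap_edge /= ltn_ord eqxx.
- by rewrite -y_sum sum_vertices.
- by move=> a b a0 b0 ab; exact: lagrangian_complete_ge.
Qed.

Local Close Scope ring_scope.

Theorem theorem1p11 (R : realType) (l : nat) (hl : (0 < l)%N)
    (G : {set {set 'I_l}}) (hG : is_3graph G) (hlc : left_compressed G)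
    (hm : #|G| = ('C(l - 1, 3) + 'C(l - 2, 2))%N)
    (i j : nat) (hj : (1 <= j)%N) (hij : (j <= i)%N)
    (hfirst : first_triples (complete3 l :\: G) (j + 1) =
       rcons [seq triple l (l - 2 - j + k) (l - 2) (l - 1) | k <- iota 0 j]
             (triple l (l - 2 - i) (l - 2) l)) :
  (lagrangian R G < lagrangian R (complete3 (l - 1)))%R.
Proof.
have [sub_C after_last] := first_triples_rcons hfirst.
have last_card : #|triple l (l - 2 - i) (l - 2) l| = 3.
  have : triple l (l - 2 - i) (l - 2) l \in complete3 l :\: G.
    by apply: sub_C; rewrite mem_rcons mem_head.
  by rewrite !inE => /andP[_ /eqP].
have l3 : 3 <= l by rewrite -last_card -[leqRHS]card_ord max_card.
case: l l3 {hl} G hG hlc hm hfirst sub_C after_last last_card => [|[|[|n]]] // _.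
rewrite !subSS !subn0 => G hG hlc hm _ sub_C after_last last_card.
apply: (lagrangian_lt _ hG hlc hj hij _ _ sub_C after_last).
  (* If [i > n], the truncated label [n.+1 - i] is 0, which names no vertex, and the last triple
     would have at most two elements. *)
  rewrite leqNgt; apply/negP => ni.
  have : #|triple n.+3 (n.+1 - i) n.+1 n.+3| <= #|[set vP n; vR n]|.
    apply/subset_leq_card/subsetP => v; rewrite !inE (_ : n.+1 - i = 0); last by lia.
    by rewrite /= !eqSS -!val_eqE.
  by rewrite last_card cards2; case: (_ != _).
(* Pascal's rule twice: ['C(n+3, 3) - 'C(n+2, 3) - 'C(n+1, 2) = 'C(n+2, 2) - 'C(n+1, 2) = n + 1]. *)
rewrite cardsD (setIidPr hG) card_draws card_ord hm.
by have := binS n.+2 2; have := binS n.+1 1; rewrite bin1; lia.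
Qed.
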